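(* Let $(M,g,\phi,\xi,\eta)$ be a $(2n+1)$-dimensional Kenmotsu manifold and let $(g,V,\lambda,\mu)$ be a gradient conformal $\eta$-Ricci soliton on $M$. Then the potential vector field $V$ is pointwise collinear with the characteristic vector field $\xi$, i.e. there is a function $h$ on $M$ with $V=h\,\xi$.
   Context: An almost contact metric manifold $(M,g,\phi,\xi,\eta)$ of dimension $2n+1$ ($n\ge 1$) is a smooth Riemannian manifold $(M,g)$ with a $(1,1)$-tensor field $\phi$, a vector field $\xi$ (the characteristic vector field) and a 1-form $\eta$ such that $\phi^2=-I+\eta\otimes\xi$, $\eta(\xi)=1$, $\eta(X)=g(X,\xi)$ and $g(\phi X,\phi Y)=g(X,Y)-\eta(X)\eta(Y)$ for all vector fields $X,Y$. It is a Kenmotsu manifold if its Levi-Civita connection $\nabla$ satisfies $(\nabla_X\phi)Y=g(\phi X,Y)\xi-\eta(Y)\phi X$ for all $X,Y$. A gradient conformal $\eta$-Ricci soliton $(g,V,\lambda,\mu)$ on a $(2n+1)$-dimensional almost contact metric manifold consists of a vector field $V=Df$, the gradient of a smooth function $f$ on $M$, and real constants $\lambda,\mu$ such that $$\mathrm{Hess} f+S+\left[\lambda-\left(\tfrac{p}{2}+\tfrac{1}{2n+1}\right)\right]g+\mu\,\eta\otimes\eta=0,$$ where $S$ is the Ricci tensor of $g$ and $p$ (the conformal pressure) is a scalar that is constant on $M$. $V$ is called the potential vector field. *)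

(* Defs.v *)
From HB Require Import structures.
From mathcomp Require Import all_boot all_order all_algebra.
From mathcomp Require Import all_classical all_reals all_analysis.

Set Implicit Arguments.
Unset Strict Implicit.
Unset Printing Implicit Defensive.

Import Order.TTheory GRing.Theory Num.Theory.
Import numFieldNormedType.Exports.

Local Open Scope classical_set_scope.
Local Open Scope ring_scope.

(* Conventions.  Tangent vectors are row vectors of components, so that linear
   maps act on the right, as for the library jacobian:
   ['D_v f a = v *m 'J f a].  Tensor fields are given by their components in
   every chart, as functions of the coordinates; values outside the image of
   the chart are irrelevant. *)

Section Smooth.
Context {R : realType} {m : nat} {W : normedModType R}.

Definition partial (i : 'I_m) (f : 'rV[R]_m -> W) : 'rV[R]_m -> W :=
  fun x => 'D_(delta_mx 0 i) f x.

Definition iter_partial (s : seq 'I_m) (f : 'rV[R]_m -> W) : 'rV[R]_m -> W :=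
  foldr partial f s.

(* [U] is meant to be open: partial derivatives of every order exist and are
   differentiable (hence continuous) on [U], that is, [f] is C^infinity. *)
Definition smooth_on (U : set 'rV[R]_m) (f : 'rV[R]_m -> W) : Prop :=
  forall (s : seq 'I_m) x, U x -> differentiable (iter_partial s f) x.

End Smooth.

(* A Hausdorff second countable space with a smooth atlas; [param c] is the
   inverse of the coordinate map [coordinate c] on its image.  The atlas need not be
   maximal. *)
Record smooth_manifold (R : realType) (m : nat) := SmoothManifold {
  points :> topologicalType ;
  manifold_hausdorff : hausdorff_space points ;
  manifold_second_countable : @second_countable points ;
  chart : Type ;
  dom : chart -> set points ;
  coordinate : chart -> points -> 'rV[R]_m ;
  param : chart -> 'rV[R]_m -> points ;
  dom_open : forall c, open (dom c) ;
  dom_cover : forall q, exists c, dom c q ;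
  image_open : forall c, open (coordinate c @` dom c) ;
  coordinateK : forall c q, dom c q -> param c (coordinate c q) = q ;
  coordinate_continuous : forall c, {within dom c, continuous (coordinate c)} ;
  param_continuous : forall c,
    {within coordinate c @` dom c, continuous (param c)} ;
  transition_smooth : forall c d,
    smooth_on (coordinate c @` (dom c `&` dom d)) (coordinate d \o param c)
}.

Section ManifoldObjects.
Context {R : realType} {m : nat} (M : smooth_manifold R m).

Definition chart_image (c : chart M) : set 'rV[R]_m := coordinate c @` dom c.

Definition overlap (c d : chart M) : set 'rV[R]_m :=
  coordinate c @` (dom c `&` dom d).

Definition transition (c d : chart M) : 'rV[R]_m -> 'rV[R]_m :=
  coordinate d \o param c.

Definition smooth_function (f : M -> R) : Prop :=
  forall c : chart M, smooth_on (chart_image c) (f \o param c).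

Record vector_field := VectorField {
  vf_comp :> chart M -> 'rV[R]_m -> 'rV[R]_m ;
  vf_smooth : forall c, smooth_on (chart_image c) (vf_comp c) ;
  vf_transform : forall c d x, overlap c d x ->
    vf_comp d (transition c d x) = vf_comp c x *m 'J (transition c d) x
}.

Record one_form := OneForm {
  of_comp :> chart M -> 'rV[R]_m -> 'cV[R]_m ;
  of_smooth : forall c, smooth_on (chart_image c) (of_comp c) ;
  of_transform : forall c d x, overlap c d x ->
    of_comp c x = 'J (transition c d) x *m of_comp d (transition c d x)
}.

Record tensor11_field := Tensor11Field {
  tf_comp :> chart M -> 'rV[R]_m -> 'M[R]_m ;
  tf_smooth : forall c, smooth_on (chart_image c) (tf_comp c) ;
  tf_transform : forall c d x, overlap c d x ->
    tf_comp c x *m 'J (transition c d) x =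
    'J (transition c d) x *m tf_comp d (transition c d x)
}.

Record riemannian_metric := RiemannianMetric {
  g_comp :> chart M -> 'rV[R]_m -> 'M[R]_m ;
  g_smooth : forall c, smooth_on (chart_image c) (g_comp c) ;
  g_transform : forall c d x, overlap c d x ->
    g_comp c x = 'J (transition c d) x *m g_comp d (transition c d x)
                 *m ('J (transition c d) x)^T ;
  g_sym : forall c x, chart_image c x -> (g_comp c x)^T = g_comp c x ;
  g_pos : forall c x (u : 'rV[R]_m), chart_image c x -> u != 0 ->
    0 < (u *m g_comp c x *m u^T) 0 0
}.

End ManifoldObjects.

Section PointwiseOperations.
Context {R : realType} {m : nat} {M : smooth_manifold R m}.

Definition form_at (eta : one_form M) (c : chart M) (x u : 'rV[R]_m) : R :=
  (u *m eta c x) 0 0.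

Definition endo_at (phi : tensor11_field M) (c : chart M) (x u : 'rV[R]_m) :
  'rV[R]_m := u *m phi c x.

Definition metric_at (g : riemannian_metric M) (c : chart M)
  (x u v : 'rV[R]_m) : R := (u *m g c x *m v^T) 0 0.

End PointwiseOperations.

(* Bilinear expression u^i v^j Gamma_ij^k(x), where the row vector [G i j x]
   holds the components of nabla_{d_i} d_j. *)
Definition christoffel (R : realType) (m : nat)
    (G : 'I_m -> 'I_m -> 'rV[R]_m -> 'rV[R]_m) (x u v : 'rV[R]_m) : 'rV[R]_m :=
  \sum_(i < m) \sum_(j < m) (u 0 i * v 0 j) *: G i j x.

(* Affine connection on the tangent bundle.  The transformation law is the
   usual inhomogeneous one; it says that [nabla] below does not depend on the
   chart. *)
Record connection (R : realType) (m : nat) (M : smooth_manifold R m) :=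
  Connection {
  conn_coef :> chart M -> 'I_m -> 'I_m -> 'rV[R]_m -> 'rV[R]_m ;
  conn_smooth : forall c i j, smooth_on (chart_image c) (conn_coef c i j) ;
  conn_transform : forall c d x (u v : 'rV[R]_m), overlap c d x ->
    christoffel (conn_coef c) x u v *m 'J (transition c d) x =
    'D_u (fun y => 'D_v (transition c d) y) x +
    christoffel (conn_coef d) (transition c d x)
      (u *m 'J (transition c d) x) (v *m 'J (transition c d) x)
}.

(* Calculus in a chart [c], on vector fields [X Y Z] defined on its image. *)
Section Calculus.
Context {R : realType} {m : nat} {M : smooth_manifold R m}.
Implicit Types (D : connection M) (c : chart M) (X Y Z : 'rV[R]_m -> 'rV[R]_m).

Definition bracket X Y : 'rV[R]_m -> 'rV[R]_m :=
  fun x => 'D_(X x) Y x - 'D_(Y x) X x.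

Definition nabla D c X Y : 'rV[R]_m -> 'rV[R]_m :=
  fun x => 'D_(X x) Y x + christoffel (D c) x (X x) (Y x).

(* (nabla_X phi) Y *)
Definition nabla_endo D (phi : tensor11_field M) c X Y : 'rV[R]_m -> 'rV[R]_m :=
  fun x => nabla D c X (fun y => endo_at phi c y (Y y)) x
           - endo_at phi c x (nabla D c X Y x).

(* R(X, Y) Z *)
Definition curvature D c X Y Z : 'rV[R]_m -> 'rV[R]_m :=
  fun x => nabla D c X (nabla D c Y Z) x - nabla D c Y (nabla D c X Z) x
           - nabla D c (bracket X Y) Z x.

(* S(Y, Z) = trace (X |-> R(X, Y) Z), computed in the coordinate frame. *)
Definition ricci D c Y Z : 'rV[R]_m -> R :=
  fun x => \sum_(i < m) (curvature D c (cst (delta_mx 0 i)) Y Z x) 0 i.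

(* X (Y f) - (nabla_X Y) f *)
Definition hessian D (f : M -> R) c X Y : 'rV[R]_m -> R :=
  fun x => 'D_(X x) (fun y => 'D_(Y y) (f \o param c) y) x
           - 'D_(nabla D c X Y x) (f \o param c) x.

End Calculus.

Section Structures.
Context {R : realType} {m : nat} {M : smooth_manifold R m}.

Definition torsion_free (D : connection M) : Prop :=
  forall (c : chart M) (X Y : 'rV[R]_m -> 'rV[R]_m),
    smooth_on (chart_image c) X -> smooth_on (chart_image c) Y ->
  forall x, chart_image c x ->
    nabla D c X Y x - nabla D c Y X x = bracket X Y x.

Definition metric_compatible (g : riemannian_metric M) (D : connection M) :
    Prop :=
  forall (c : chart M) (X Y Z : 'rV[R]_m -> 'rV[R]_m),
    smooth_on (chart_image c) X -> smooth_on (chart_image c) Y ->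
    smooth_on (chart_image c) Z ->
  forall x, chart_image c x ->
    'D_(X x) (fun y => metric_at g c y (Y y) (Z y)) x =
    metric_at g c x (nabla D c X Y x) (Z x) +
    metric_at g c x (Y x) (nabla D c X Z x).

Definition levi_civita (g : riemannian_metric M) (D : connection M) : Prop :=
  torsion_free D /\ metric_compatible g D.

(* V = D f *)
Definition is_gradient (g : riemannian_metric M) (f : M -> R)
    (V : vector_field M) : Prop :=
  forall (c : chart M) (x u : 'rV[R]_m), chart_image c x ->
    metric_at g c x (V c x) u = 'D_u (f \o param c) x.

Definition almost_contact_metric (g : riemannian_metric M)
    (phi : tensor11_field M) (xi : vector_field M) (eta : one_form M) : Prop :=
  forall (c : chart M) (x : 'rV[R]_m), chart_image c x ->
  [/\ forall u, endo_at phi c x (endo_at phi c x u) =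
                - u + form_at eta c x u *: xi c x,
      form_at eta c x (xi c x) = 1,
      forall u, form_at eta c x u = metric_at g c x u (xi c x) &
      forall u v, metric_at g c x (endo_at phi c x u) (endo_at phi c x v) =
                  metric_at g c x u v - form_at eta c x u * form_at eta c x v].

(* [D] is meant to be the Levi-Civita connection of [g]. *)
Definition kenmotsu (g : riemannian_metric M) (D : connection M)
    (phi : tensor11_field M) (xi : vector_field M) (eta : one_form M) : Prop :=
  almost_contact_metric g phi xi eta /\
  forall (c : chart M) (X Y : 'rV[R]_m -> 'rV[R]_m),
    smooth_on (chart_image c) X -> smooth_on (chart_image c) Y ->
  forall x, chart_image c x ->
    nabla_endo D phi c X Y x =
    metric_at g c x (endo_at phi c x (X x)) (Y x) *: xi c x
    - form_at eta c x (Y x) *: endo_at phi c x (X x).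

End Structures.

(* [D] is meant to be the Levi-Civita connection of [g]; [p] is the conformal
   pressure. *)
Definition gradient_conformal_eta_ricci_soliton (R : realType) (n : nat)
    (M : smooth_manifold R (2 * n + 1)) (g : riemannian_metric M)
    (D : connection M) (eta : one_form M) (f : M -> R) (V : vector_field M)
    (lambda mu p : R) : Prop :=
  [/\ smooth_function f, is_gradient g f V &
  forall (c : chart M) (X Y : 'rV[R]_(2 * n + 1) -> 'rV[R]_(2 * n + 1)),
    smooth_on (chart_image c) X -> smooth_on (chart_image c) Y ->
  forall x, chart_image c x ->
    hessian D f c X Y x + ricci D c X Y x
    + (lambda - (p / 2 + 1 / (2 * n + 1)%:R)) * metric_at g c x (X x) (Y x)
    + mu * (form_at eta c x (X x) * form_at eta c x (Y x)) = 0].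

(* V = h xi at every point of M. *)
Definition pointwise_collinear (R : realType) (m : nat)
    (M : smooth_manifold R m) (V xi : vector_field M) : Prop :=
  exists h : M -> R, forall (c : chart M) (q : M), dom c q ->
    V c (coordinate c q) = h q *: xi c (coordinate c q).

(* Main.v *)
Require Import Defs.
From mathcomp Require Import all_boot all_order all_algebra.
From mathcomp Require Import all_classical all_reals all_analysis.
From mathcomp Require Import ring lra.

(* Put [u = xi f].  On a Kenmotsu manifold [nabla_X xi = X - eta(X) xi], so that
   [d eta = 0], [R(X, Y) xi = eta(X) Y - eta(Y) X] and
   [S(X, xi) = (1 - m) eta(X)], where [m = 2n + 1] is the dimension.  The soliton
   equation evaluated on [(X, xi)] then reads [du = df + (a - u) eta] for a
   constant [a].  Its exterior derivative is [du /\ eta = 0], hence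
   [df /\ eta = 0] and, contracting with [xi], [df = u eta], i.e. [V = u xi]. *)

Set Implicit Arguments.
Unset Strict Implicit.
Unset Printing Implicit Defensive.

Import Order.TTheory GRing.Theory Num.Theory.
Import numFieldNormedType.Exports.

Local Open Scope classical_set_scope.
Local Open Scope ring_scope.

(** * Symmetry of second derivatives and product rules in normed spaces *)

Lemma differentiable_near_le (R : realType) (V W : normedModType R)
    (f : V -> W) (a : V) (e : R) : differentiable f a -> 0 < e ->
  \forall h \near (0 : V), `|f (h + a) - f a - 'd f a h| <= e * `|h|.
Proof.
move=> /diff_locally; set k := 'o _ => df e0; near=> h.
have := congr1 (fun k => k h) df => /=; rewrite /cst /= => ->.
have -> : f a + 'd f a h + k h - f a - 'd f a h = k h.
  by rewrite -addrA -opprD addrC addKr.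
near: h; exact: (littleoP [littleo of k]).
Unshelve. all: by end_near. Qed.

Lemma is_derive_line (R : realType) (V W : normedModType R) (f : V -> W)
    (a u : V) (s : R) : differentiable f (a + s *: u) ->
  is_derive s (1 : R) (fun r : R => f (a + r *: u)) ('D_u f (a + s *: u)).
Proof.
move=> df; have d1 : is_diff s (fun r : R => a + r *: u) ( *:%R^~ u).
  by apply: is_diff_eq; rewrite add0r.
have d2 : is_diff s (f \o (fun r : R => a + r *: u))
    ('d f (a + s *: u) \o ( *:%R^~ u)).
  by apply: is_diff_comp; exact: differentiableP.
apply: DeriveDef; first by apply: diff_derivable; exact: ex_diff.
by rewrite deriveE; [rewrite diff_val /= scale1r deriveE|exact: ex_diff].
Qed.

(* The mean value theorem applied to [s |-> f (a + t v + s u) - f (a + s u)];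
   the second difference is symmetric in [u] and [v], whence [derive_comm]. *)
Lemma second_difference_near (R : realType) (V : normedModType R) (f : V -> R)
    (a u v : V) (e : R) :
  (\forall x \near a, differentiable f x) -> differentiable ('D_u f) a ->
  0 < e -> \forall t \near (0 : R)^'+,
    `|f (a + t *: v + t *: u) - f (a + t *: v) - f (a + t *: u) + f a
      - t ^+ 2 * 'D_v ('D_u f) a| <= e * t ^+ 2.
Proof.
move=> fd ud e0.
set k := 2 * (`|u| + `|v|) + 1.
have k0 : 0 < k by rewrite ltr_wpDl// mulr_ge0// addr_ge0.
have ek0 : 0 < e / k by rewrite divr_gt0.
have P2 := differentiable_near_le ud ek0.
have P1 : \forall h \near (0 : V), differentiable f (h + a).
  by move: fd; rewrite (near_shift 0 a) /=; apply: filterS => h /=; rewrite subr0.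
have : \forall h \near (0 : V), differentiable f (h + a) /\
    `|'D_u f (h + a) - 'D_u f a - 'd ('D_u f) a h| <= e / k * `|h|.
  by apply: filterS2 P1 P2 => h; split.
move=> /nbhs_ballP[d /= d0 P].
(* The boolean [b] covers the displacements t v + s u and s u at once; these lead to the two points
   compared by [phi]. *)
have small (s t : R) : 0 <= s -> s <= t -> t < d / k -> forall b : bool,
    ball (0 : V) d (t *: (b%:R *: v) + s *: u).
  move=> s0 st td b; rewrite -ball_normE /= sub0r normrN.
  rewrite (le_lt_trans (ler_normD _ _))// !normrZ normr_nat.
  have tk : t * k < d by rewrite -ltr_pdivlMr.
  rewrite (ger0_norm s0) ger0_norm ?(le_trans s0)//; apply: le_lt_trans tk.
  have t0 := le_trans s0 st; have := ler_wpM2r (normr_ge0 u) st.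
  have := mulr_ge0 t0 (normr_ge0 u); have := mulr_ge0 t0 (normr_ge0 v).
  by case: b => /=; rewrite ?mul1r ?mul0r ?mulr0 /k; lra.
have Pd (s t : R) (b : bool) : 0 <= s -> s <= t -> t < d / k ->
    forall h, h = t *: (b%:R *: v) + s *: u -> differentiable f (h + a) /\
    `|'D_u f (h + a) - 'D_u f a - 'd ('D_u f) a h| <= e / k * `|h|.
  by move=> s0 st td _ ->; exact/P/small.
near=> t.
have t0 : 0 < t by near: t; exact: nbhs_right_gt.
have td : t < d / k by near: t; apply: nbhs_right_lt; rewrite divr_gt0.
pose phi (s : R) : R := f (a + t *: v + s *: u) - f (a + s *: u).
have dphi (s : R) : 0 <= s -> s <= t -> is_derive s (1 : R) phi
    ('D_u f (a + t *: v + s *: u) - 'D_u f (a + s *: u)).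
  move=> s0 st; apply: is_deriveB; apply: is_derive_line.
    have [+ _] := Pd s t true s0 st td _ erefl.
    by rewrite scale1r addrC addrA.
  have [+ _] := Pd s t false s0 st td _ erefl.
  by rewrite scale0r scaler0 add0r addrC.
have phi1 (s : R) : s \in `]0, t[%R -> is_derive s (1 : R) phi
    ('D_u f (a + t *: v + s *: u) - 'D_u f (a + s *: u)).
  by rewrite in_itv /= => /andP[s0 st]; apply: dphi; exact: ltW.
have phi0 : {within `[0, t], continuous phi}.
  apply: continuous_in_subspaceT => s; rewrite inE /= in_itv /= => /andP[s0 st].
  by apply: differentiable_continuous; apply/derivable1_diffP; apply: ex_derive;
    exact: dphi.
have [s sin E] := MVT t0 phi1 phi0.
move: sin; rewrite in_itv /= => /andP[/ltW s0 /ltW st].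
have -> : f (a + t *: v + t *: u) - f (a + t *: v) - f (a + t *: u) + f a =
    phi t - phi 0 by rewrite /phi scale0r !addr0; ring.
have [_ E1] := Pd s t true s0 st td _ erefl.
have [_ E2] := Pd s t false s0 st td _ erefl.
move: E1 E2; rewrite scale1r scale0r scaler0 add0r.
have -> : 'd ('D_u f) a (t *: v + s *: u) =
    t * 'd ('D_u f) a v + s * 'd ('D_u f) a u by rewrite linearD !linearZ.
have -> : 'd ('D_u f) a (s *: u) = s * 'd ('D_u f) a u by rewrite linearZ.
rewrite E (deriveE v ud) subr0.
have <- : a + t *: v + s *: u = t *: v + s *: u + a by rewrite [RHS]addrC addrA.
rewrite [s *: u + a]addrC.
set A := 'D_u f _; set B := 'D_u f (_ + _) => E1 E2.
set dv := 'd _ _ v; set du := 'd _ _ u in E1 E2 *.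
have n1 : `|t *: v + s *: u| <= t * (`|v| + `|u|).
  rewrite (le_trans (ler_normD _ _))// !normrZ (ger0_norm s0) (gtr0_norm t0).
  by rewrite mulrDr lerD2l ler_wpM2r.
have n2 : `|s *: u| <= t * `|u| by rewrite normrZ (ger0_norm s0) ler_wpM2r.
(* By the mean value theorem the second difference is [t * (A - B)]; in the expansions of [A] and
   [B] at [a] the terms [s * du] cancel and leave [t * dv]. *)
rewrite (_ : _ - _ = t * ((A - 'D_u f a - (t * dv + s * du)) -
  (B - 'D_u f a - s * du))); last by ring.
rewrite normrM (gtr0_norm t0) expr2 mulrCA ler_pM2l//.
rewrite (le_trans (ler_normB _ _))// (le_trans (lerD E1 E2))// -mulrDr.
rewrite -mulrA ler_pM2l// mulrC ler_pdivrMr//.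
have := mulr_ge0 (ltW t0) (normr_ge0 v); rewrite /k; lra.
Unshelve. all: by end_near. Qed.

(** Used with [F] the second difference and [T = t ^+ 2], so that both mixed derivatives approximate
    the same quotient. *)
Lemma close_of_close_multiples (R : realType) (F T X Y e : R) : 0 < T ->
  `|F - T * X| <= e / 2 * T -> `|F - T * Y| <= e / 2 * T -> `|X - Y| <= e.
Proof.
move=> T0 EX EY; rewrite -(ler_pM2r T0) -{1}(gtr0_norm T0) -normrM.
have -> : (X - Y) * T = (F - T * Y) - (F - T * X) by ring.
rewrite (le_trans (ler_normB _ _))// (le_trans (lerD EY EX))//.
by rewrite -mulrDl -splitr.
Qed.

(** Young's form of the symmetry theorem: it asks for differentiability of the first derivatives at
    [a] alone, which [xi_deriv] will get from the soliton equation. *)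
Lemma derive_comm (R : realType) (V : normedModType R) (f : V -> R) (a u v : V) :
  (\forall x \near a, differentiable f x) ->
  differentiable ('D_u f) a -> differentiable ('D_v f) a ->
  'D_v ('D_u f) a = 'D_u ('D_v f) a.
Proof.
move=> fd ud vd; apply/eqP; rewrite -subr_eq0 -normr_le0.
apply/ler_addgt0Pr => /= e e0; rewrite add0r.
have e20 : 0 < e / 2 by rewrite divr_gt0.
have P := filterI (second_difference_near v fd ud e20)
  (second_difference_near u fd vd e20).
have [t [t0 [EX EY]]] := filter_ex (filterI (nbhs_right_gt (0 : R)) (P _)).
apply: (close_of_close_multiples (exprn_gt0 2 t0) EX).
by rewrite (addrAC a) [X in X + f a]addrAC.
Qed.

(** The increments of [f] and [h] agree near [a], so the differential of [f] also serves for [h],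
    and [diff_unique] identifies it with ['d h a]. *)
Lemma near_eq_differentiable (R : realType) (V W : normedModType R)
    (f h : V -> W) (a : V) :
  (\forall x \near a, f x = h x) -> differentiable f a -> differentiable h a.
Proof.
move=> fh df; have dfc : continuous ('d f a) by exact: diff_continuous.
have E : h \o shift a = cst (h a) + 'd f a +o_ (0 : V) id.
  apply/eqaddoP => _/posnumP[e].
  have fh0 : \forall k \near (0 : V), f (k + a) = h (k + a).
    by move: fh; rewrite (near_shift 0 a); apply: filterS => k /=; rewrite subr0.
  have e0 : 0 < e%:num by [].
  apply: filterS2 fh0 (differentiable_near_le df e0) => k fhk.
  by rewrite fhk (nbhs_singleton fh) /= /cst -addrA -opprD.
have d_eq := diff_unique dfc E.
by apply/diff_locallyP; rewrite d_eq.
Qed.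

Lemma differentiable_mx_entry (R : realType) (V : normedModType R) m n
    (F : V -> 'M[R]_(m, n)) (x : V) i j :
  differentiable F x -> differentiable (fun y => F y i j) x.
Proof.
move=> dF; apply: (differentiable_comp (g := fun N : 'M[R]_(m, n) => N i j)) => //.
exact: differentiable_coord.
Qed.

Lemma is_derive_mul (R : realType) (V : normedModType R) (k h : V -> R)
    (x v : V) : differentiable k x -> differentiable h x ->
  is_derive x v (fun y => k y * h y) ('D_v k x * h x + k x * 'D_v h x).
Proof.
move=> dk dh; have dkv := diff_derivable (v := v) dk.
have dhv := diff_derivable (v := v) dh.
rewrite -[fun y => _]/(k * h); apply: DeriveDef; first exact: (derivableM dkv dhv).
by rewrite (deriveM dkv dhv) addrC; congr (_ + _); rewrite mulrC.
Qed.

Lemma is_derive_scale_mx (R : realType) (V : normedModType R) m n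
    (k : V -> R) (F : V -> 'M[R]_(m, n)) (x v : V) :
  differentiable k x -> differentiable F x ->
  is_derive x v (fun y => k y *: F y) ('D_v k x *: F x + k x *: 'D_v F x).
Proof.
move=> dk dF.
have dkF i j := is_derive_mul v dk (differentiable_mx_entry i j dF).
have E i j : (fun y => (k y *: F y) i j) = (fun y => k y * F y i j).
  by apply/funext => y; rewrite mxE.
have d : derivable (fun y => k y *: F y) x v.
  by apply/derivable_mxP => i j; rewrite E; exact: ex_derive.
apply: DeriveDef => //.
rewrite derive_mx// (derive_mx (diff_derivable (v := v) dF)).
by apply/matrixP => i j; rewrite !mxE E derive_val.
Qed.

Lemma derive_partial (R : realType) m (W : normedModType R)
    (F : 'rV[R]_m -> W) (x v : 'rV[R]_m) : differentiable F x ->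
  'D_v F x = \sum_(i < m) v 0 i *: 'D_(delta_mx 0 i) F x.
Proof.
move=> dF; rewrite deriveE// {1}[v]row_sum_delta linear_sum.
by apply: eq_bigr => i _; rewrite linearZ deriveE.
Qed.

(** * Smooth functions and the covariant derivative in coordinates *)

Section SmoothOn.
Context {R : realType} {m : nat} {W : normedModType R}.
Implicit Types (U : set 'rV[R]_m) (F : 'rV[R]_m -> W).

Lemma smooth_on_differentiable U F x :
  smooth_on U F -> U x -> differentiable F x.
Proof. by move=> sF Ux; exact: (sF [::]). Qed.

Lemma smooth_on_partial U F i x :
  smooth_on U F -> U x -> differentiable ('D_(delta_mx 0 i) F) x.
Proof. by move=> sF Ux; exact: (sF [:: i]). Qed.

Lemma smooth_on_cst U (w : W) : smooth_on U (cst w).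
Proof.
(* The constant is existentially quantified because one derivative turns [w] into 0. *)
move=> s x _; suff [w' ->] : exists w', iter_partial s (cst w) = cst w' :> (_ -> W).
  exact: differentiable_cst.
elim: s => [|i s [w' IH]]; first by exists w.
exists 0; rewrite /= IH; apply/funext => y; exact: derive_cst.
Qed.

End SmoothOn.

Section Christoffel.
Context {R : realType} {m : nat} (G : 'I_m -> 'I_m -> 'rV[R]_m -> 'rV[R]_m).

Lemma christoffel0l x v : christoffel G x 0 v = 0.
Proof.
rewrite /christoffel big1// => i _; rewrite big1// => j _.
by rewrite mxE mul0r scale0r.
Qed.

Lemma christoffelDr x u v w :
  christoffel G x u (v + w) = christoffel G x u v + christoffel G x u w.
Proof.
rewrite /christoffel -big_split; apply: eq_bigr => i _ /=.
by rewrite -big_split; apply: eq_bigr => j _ /=; rewrite mxE mulrDr scalerDl.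
Qed.

Lemma christoffelZr x u k v :
  christoffel G x u (k *: v) = k *: christoffel G x u v.
Proof.
rewrite /christoffel scaler_sumr; apply: eq_bigr => i _ /=.
by rewrite scaler_sumr; apply: eq_bigr => j _ /=; rewrite mxE mulrCA scalerA.
Qed.

End Christoffel.

Section Nabla.
Context {R : realType} {m : nat} {M : smooth_manifold R m}.
Context (D : connection M) (c : chart M).
Implicit Types X Y Z : 'rV[R]_m -> 'rV[R]_m.

(** Only the germ of the differentiated field matters; identities valid on a chart image, which is
    open, can thus be differentiated. *)
Lemma near_eq_nabla X Y Z x : (\forall y \near x, Y y = Z y) ->
  nabla D c X Y x = nabla D c X Z x.
Proof. by move=> YZ; rewrite /nabla (near_eq_derive _ YZ) (nbhs_singleton YZ). Qed.

Lemma nabla0r X x : nabla D c X (cst 0) x = 0.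
Proof.
rewrite /nabla derive_cst add0r /cst -[X in christoffel _ _ _ X](scale0r 0).
by rewrite christoffelZr scale0r.
Qed.

Lemma nabla0l Y x : nabla D c (cst 0) Y x = 0.
Proof. by rewrite /nabla derive0 christoffel0l addr0. Qed.

Lemma nablaBr X Y Z x : derivable Y x (X x) -> derivable Z x (X x) ->
  nabla D c X (Y - Z) x = nabla D c X Y x - nabla D c X Z x.
Proof.
move=> dY dZ; rewrite /nabla (deriveB dY dZ).
rewrite -[(Y - Z) x]/(Y x - Z x) -[- Z x]scaleN1r.
rewrite christoffelDr christoffelZr scaleN1r.
by rewrite addrACA opprD.
Qed.

Lemma nablaZr X (k : 'rV[R]_m -> R) Y x : differentiable k x -> differentiable Y x ->
  nabla D c X (fun y => k y *: Y y) x = 'D_(X x) k x *: Y x + k x *: nabla D c X Y x.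
Proof.
move=> dk dY; rewrite /nabla; have [_ ->] := is_derive_scale_mx (X x) dk dY.
by rewrite christoffelZr scalerDr addrA.
Qed.

End Nabla.

(** * Pointwise algebra of an almost contact metric structure *)

Section Pointwise.
Context {R : realType} {m : nat} {M : smooth_manifold R m}.
Context (g : riemannian_metric M) (phi : tensor11_field M) (xi : vector_field M)
  (eta : one_form M) (c : chart M).

Lemma chart_image_near x : chart_image c x -> \forall y \near x, chart_image c y.
Proof. by move=> cx; apply: open_nbhs_nbhs; split => //; exact: image_open. Qed.

Lemma metric_atC x u v : chart_image c x ->
  metric_at g c x u v = metric_at g c x v u.
Proof.
move=> cx; have E : (u *m g c x *m v^T)^T = v *m g c x *m u^T.
  by rewrite !trmx_mul trmxK (g_sym g cx) mulmxA.
by rewrite /metric_at -E [RHS]mxE.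
Qed.

Lemma metric_at_subr x u v w :
  metric_at g c x u (v - w) = metric_at g c x u v - metric_at g c x u w.
Proof. by rewrite /metric_at linearB mulmxBr !mxE. Qed.

Lemma metric_at_scaler x u k w :
  metric_at g c x u (k *: w) = k * metric_at g c x u w.
Proof. by rewrite /metric_at linearZ -scalemxAr !mxE. Qed.

Lemma metric_at_subl x u v w :
  metric_at g c x (u - v) w = metric_at g c x u w - metric_at g c x v w.
Proof. by rewrite /metric_at !mulmxBl !mxE. Qed.

Lemma metric_at_scalel x k u w :
  metric_at g c x (k *: u) w = k * metric_at g c x u w.
Proof. by rewrite /metric_at -!scalemxAl !mxE. Qed.

Lemma metric_at_eq0 x u : chart_image c x -> metric_at g c x u u = 0 -> u = 0.
Proof.
move=> cx guu; apply: contrapT => /eqP u0.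
by have := g_pos g cx u0; rewrite -[X in 0 < X]/(metric_at g c x u u) guu ltxx.
Qed.

Lemma form_at_scale x k u : form_at eta c x (k *: u) = k * form_at eta c x u.
Proof. by rewrite /form_at -scalemxAl !mxE. Qed.

Lemma form_at_delta x j : form_at eta c x (delta_mx 0 j) = eta c x j 0.
Proof. by rewrite /form_at -rowE mxE. Qed.

Hypothesis acm : almost_contact_metric g phi xi eta.

Lemma form_at_xi x : chart_image c x -> form_at eta c x (xi c x) = 1.
Proof. by case/acm. Qed.

Lemma form_at_metric x u : chart_image c x ->
  form_at eta c x u = metric_at g c x u (xi c x).
Proof. by case/acm. Qed.

Lemma endo_endo x u : chart_image c x -> endo_at phi c x (endo_at phi c x u) =
  - u + form_at eta c x u *: xi c x.
Proof. by case/acm. Qed.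

(** By the compatibility axiom, g(phi xi, phi xi) = g(xi, xi) - eta(xi)^2 = 1 - 1 = 0. *)
Lemma endo_xi x : chart_image c x -> endo_at phi c x (xi c x) = 0.
Proof.
move=> cx; apply: (metric_at_eq0 cx); have [_ _ _ ->] := acm cx.
by rewrite -form_at_metric// form_at_xi// mulr1 subrr.
Qed.

(** The evaluations of phi^3 u as phi^2 (phi u) and as phi (phi^2 u) differ by eta(phi u) xi, since
    phi xi = 0; applying eta gives the claim. *)
Lemma form_endo x u : chart_image c x -> form_at eta c x (endo_at phi c x u) = 0.
Proof.
move=> cx; set w := endo_at phi c x u.
have := endo_endo w cx; rewrite /w (endo_endo u cx) {1}/endo_at mulmxDl mulNmx.
rewrite -scalemxAl -![_ *m phi c x]/(endo_at phi c x _) endo_xi// scaler0.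
move=> /addrI /(congr1 (form_at eta c x)).
rewrite form_at_scale form_at_xi// mulr1 => <-.
by rewrite /form_at mul0mx mxE.
Qed.

End Pointwise.

(** * Covariant derivative, curvature and Ricci tensor along xi on a Kenmotsu manifold *)

Section Kenmotsu.
Context {R : realType} {m : nat} {M : smooth_manifold R m}.
Context (g : riemannian_metric M) (D : connection M) (phi : tensor11_field M)
  (xi : vector_field M) (eta : one_form M) (c : chart M).
Hypotheses (lc : levi_civita g D) (ken : kenmotsu g D phi xi eta).
Implicit Types X Y : 'rV[R]_m -> 'rV[R]_m.

Local Notation e i := (cst (delta_mx 0 i)).
Local Notation eta_at y i := (form_at eta c y (delta_mx 0 i)).

Let acm : almost_contact_metric g phi xi eta.
Proof. by case: ken. Qed.

Let smooth_xi : smooth_on (chart_image c) (xi c).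
Proof. exact: vf_smooth. Qed.

Let smooth_e (i : 'I_m) : smooth_on (chart_image c) (e i : 'rV[R]_m -> 'rV[R]_m).
Proof. exact: smooth_on_cst. Qed.

(** Differentiating g(xi, xi) = 1 gives 2 g(nabla_X xi, xi) = 0. *)
Lemma form_nabla_xi X x : smooth_on (chart_image c) X -> chart_image c x ->
  form_at eta c x (nabla D c X (xi c) x) = 0.
Proof.
move=> sX cx; have := lc.2 c X (xi c) (xi c) sX smooth_xi smooth_xi x cx.
rewrite (near_eq_derive (g := cst (1 : R))); last first.
  apply: filterS (chart_image_near cx) => y cy.
  by rewrite -(form_at_metric acm)// (form_at_xi acm).
rewrite derive_cst [X in _ = _ + X](metric_atC g)// -(form_at_metric acm)//.
by move=> /esym/eqP; rewrite -mulr2n mulrn_eq0 => /eqP.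
Qed.

(** Since phi xi = 0, the Kenmotsu identity at Y = xi reduces to phi (nabla_X xi) = phi X. Applying
    phi again recovers nabla_X xi, because its eta component vanishes by [form_nabla_xi]. *)
Lemma nabla_xi X x : smooth_on (chart_image c) X -> chart_image c x ->
  nabla D c X (xi c) x = X x - form_at eta c x (X x) *: xi c x.
Proof.
move=> sX cx; have := ken.2 c X (xi c) sX smooth_xi x cx.
rewrite /nabla_endo (near_eq_nabla D c X (Z := cst 0)); last first.
  by apply: filterS (chart_image_near cx) => y cy; exact: (endo_xi acm).
rewrite nabla0r sub0r -(form_at_metric acm)// (form_endo acm)// scale0r sub0r.
rewrite (form_at_xi acm)// scale1r => /oppr_inj /(congr1 (endo_at phi c x)).
rewrite !(endo_endo acm)// form_nabla_xi// scale0r addr0 => /(congr1 -%R).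
by rewrite opprK => ->; rewrite opprD opprK.
Qed.

Lemma nabla_frameC i j x : chart_image c x ->
  nabla D c (e i) (e j) x = nabla D c (e j) (e i) x.
Proof.
move=> cx; apply/eqP; rewrite -subr_eq0.
rewrite (lc.1 c (e i) (e j) (@smooth_e i) (@smooth_e j) x cx).
by rewrite /bracket !derive_cst subrr.
Qed.

(** This is d eta = 0. By metric compatibility and [nabla_xi], the derivative of eta_l along e_k is
    eta(nabla_{e_k} e_l) + g(e_l, e_k) - eta_k eta_l, which is symmetric in k and l. *)
Lemma form_closed i j x : chart_image c x ->
  'D_(delta_mx 0 i) (fun y => eta_at y j) x =
  'D_(delta_mx 0 j) (fun y => eta_at y i) x.
Proof.
move=> cx.
have E k l : 'D_(delta_mx 0 k) (fun y => eta_at y l) x =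
    form_at eta c x (nabla D c (e k) (e l) x)
    + metric_at g c x (delta_mx 0 l) (delta_mx 0 k)
    - eta_at x k * eta_at x l.
  have := lc.2 c (e k) (e l) (xi c) (@smooth_e k) (@smooth_e l) smooth_xi x cx.
  rewrite (near_eq_derive (g := fun y => eta_at y l)); last first.
    by apply: filterS (chart_image_near cx) => y cy; rewrite -(form_at_metric acm).
  move=> ->; rewrite (nabla_xi (@smooth_e k) cx).
  rewrite -(form_at_metric acm)// metric_at_subr metric_at_scaler.
  by rewrite -(form_at_metric acm)// addrA.
by rewrite !E nabla_frameC// (metric_atC g)// mulrC.
Qed.

Lemma differentiable_form i x : chart_image c x ->
  differentiable (fun y => eta_at y i) x.
Proof.
move=> cx; have -> : (fun y => eta_at y i) = (fun y => eta c y i 0).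
  by apply/funext => y; exact: form_at_delta.
apply: differentiable_mx_entry.
exact: smooth_on_differentiable (@of_smooth _ _ _ eta c) cx.
Qed.

(** When nabla_{e_l} xi = e_l - eta_l xi is differentiated along e_k and antisymmetrized, the terms
    in nabla_{e_k} e_l, d_k eta_l and eta_k eta_l xi cancel by symmetry; the bracket of coordinate
    fields is 0. *)
Lemma curvature_xi i j x : chart_image c x ->
  curvature D c (e i) (e j) (xi c) x =
  eta_at x i *: delta_mx 0 j - eta_at x j *: delta_mx 0 i.
Proof.
move=> cx.
have E k l : nabla D c (e k) (nabla D c (e l) (xi c)) x = nabla D c (e k) (e l) x
    - ('D_(delta_mx 0 k) (fun y => eta_at y l) x *: xi c x
       + eta_at x l *: (delta_mx 0 k - eta_at x k *: xi c x)).
  rewrite (near_eq_nabla D c (e k)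
    (Z := e l - (fun y => eta_at y l *: xi c y))); last first.
    apply: filterS (chart_image_near cx) => y cy; exact: (nabla_xi (@smooth_e l) cy).
  have dxi := smooth_on_differentiable smooth_xi cx.
  have deta := differentiable_form l cx.
  have [dZ _] := is_derive_scale_mx (delta_mx 0 k) deta dxi.
  rewrite (nablaBr D c (X := e k) (derivable_cst _ _ _) dZ).
  by rewrite nablaZr// (nabla_xi (@smooth_e k) cx).
rewrite /curvature !E nabla_frameC// form_closed//.
rewrite (_ : bracket (e i) (e j) = cst 0) ?nabla0l; last first.
  by apply/funext => y; rewrite /bracket !derive_cst subrr.
rewrite subr0; apply/rowP => k; rewrite !mxE; ring.
Qed.

Lemma ricci_xi j x : chart_image c x ->
  ricci D c (e j) (xi c) x = (1 - m%:R) * eta_at x j.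
Proof.
move=> cx; rewrite /ricci.
(* The i-th term of the trace is eta_i delta_ij - eta_j; the first part sums to eta_j, the second to
   m eta_j. *)
under eq_bigr => i _ do rewrite curvature_xi// !mxE /= eqxx.
rewrite sumrB (bigD1 j)//= eqxx mulr1 big1 ?addr0; last first.
  by move=> i ij; rewrite (negbTE ij) mulr0.
by rewrite sumr_const card_ord mulrBl mul1r mulr_natl.
Qed.

End Kenmotsu.

(** * The soliton equation along xi and the gradient of the potential *)

Section Soliton.
Context {R : realType} {m : nat} {M : smooth_manifold R m}.
Context (g : riemannian_metric M) (D : connection M) (phi : tensor11_field M)
  (xi : vector_field M) (eta : one_form M) (f : M -> R) (V : vector_field M)
  (A B : R).
Hypotheses (lc : levi_civita g D) (ken : kenmotsu g D phi xi eta).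
Hypotheses (smooth_f : smooth_function f) (grad_f : is_gradient g f V).
(* The metric coefficient [lambda - (p / 2 + 1 / (2n + 1))] is only used through
   its being a constant [A]. *)
Hypothesis soliton : forall (c : chart M) (X Y : 'rV[R]_m -> 'rV[R]_m),
  smooth_on (chart_image c) X -> smooth_on (chart_image c) Y ->
  forall x, chart_image c x ->
  hessian D f c X Y x + ricci D c X Y x + A * metric_at g c x (X x) (Y x)
  + B * (form_at eta c x (X x) * form_at eta c x (Y x)) = 0.

Implicit Types c : chart M.

Local Notation F c := (f \o param c).
Local Notation eta_at c y i := (form_at eta c y (delta_mx 0 i)).

(** The function u = xi f in coordinates. Each term differentiates f in a fixed direction, so
    differentiability follows from that of products. *)
Definition xi_deriv (c : chart M) (y : 'rV[R]_m) : R :=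
  \sum_(k < m) xi c y 0 k * 'D_(delta_mx 0 k) (F c) y.

Let smooth_xi c : smooth_on (chart_image c) (xi c).
Proof. exact: vf_smooth. Qed.

Let smooth_e c (i : 'I_m) :
  smooth_on (chart_image c) (cst (delta_mx 0 i) : 'rV[R]_m -> 'rV[R]_m).
Proof. exact: smooth_on_cst. Qed.

Let dF c x : chart_image c x -> differentiable (F c) x.
Proof. exact: smooth_on_differentiable. Qed.

Let dpF c i x : chart_image c x -> differentiable ('D_(delta_mx 0 i) (F c)) x.
Proof. exact: smooth_on_partial. Qed.

Lemma xi_derivE c y : chart_image c y -> 'D_(xi c y) (F c) y = xi_deriv c y.
Proof. by move=> cy; rewrite derive_partial//; exact: dF. Qed.

Lemma differentiable_xi_deriv c x : chart_image c x -> differentiable (xi_deriv c) x.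
Proof.
move=> cx.
have -> : xi_deriv c =
    \sum_(k < m) (fun y => xi c y 0 k * 'D_(delta_mx 0 k) (F c) y).
  by apply/funext => y; rewrite fct_sumE.
apply: differentiable_sum => k; apply: differentiableM; last exact: dpF.
by apply: differentiable_mx_entry; exact: (smooth_on_differentiable (@smooth_xi c)).
Qed.

(** In the soliton equation on (e_j, xi), the Hessian is d_j u - (d_j f - eta_j u) by [nabla_xi],
    and the remaining terms are constant multiples of eta_j. *)
Lemma derive_xi_deriv c j x : chart_image c x ->
  'D_(delta_mx 0 j) (xi_deriv c) x = 'D_(delta_mx 0 j) (F c) x
    + (m%:R - 1 - A - B - xi_deriv c x) * eta_at c x j.
Proof.
move=> cx; have := soliton (@smooth_e c j) (@smooth_xi c) cx.
rewrite (ricci_xi lc ken)// -(form_at_metric ken.1)// (form_at_xi ken.1)//.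
rewrite /hessian (near_eq_derive (g := xi_deriv c)); last first.
  by apply: filterS (chart_image_near cx) => y; exact: xi_derivE.
rewrite (nabla_xi lc ken (@smooth_e c j) cx) (deriveE _ (dF cx)).
rewrite linearB linearZ /= -!(deriveE _ (dF cx)) xi_derivE//.
rewrite -[_ *: _]/(_ * _) => E.
(* The subtracted zero is replaced by the left side of the soliton equation, which leaves a
   polynomial identity. *)
rewrite -[LHS]subr0 -E; ring.
Qed.

(** When d_k u = d_k f + (a - u) eta_k is cross-differentiated, the symmetric terms d_j d_i f and (a
    - u) d_j eta_i drop out, leaving du /\ eta = 0. Substituting the formula for du turns this into
    df /\ eta = 0, as eta /\ eta = 0. *)
Lemma gradient_wedge_form c i j x : chart_image c x ->
  'D_(delta_mx 0 i) (F c) x * eta_at c x j =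
  'D_(delta_mx 0 j) (F c) x * eta_at c x i.
Proof.
move=> cx; set a := m%:R - 1 - A - B.
pose v k y := 'D_(delta_mx 0 k) (F c) y + (a - xi_deriv c y) * eta_at c y k.
have du := differentiable_xi_deriv cx.
have uv k : \forall y \near x, v k y = 'D_(delta_mx 0 k) (xi_deriv c) y.
  by apply: filterS (chart_image_near cx) => y cy; rewrite derive_xi_deriv.
have dv k l : is_derive x (delta_mx 0 l) (v k)
    ('D_(delta_mx 0 l) ('D_(delta_mx 0 k) (F c)) x
      + (- 'D_(delta_mx 0 l) (xi_deriv c) x * eta_at c x k
    + (a - xi_deriv c x) * 'D_(delta_mx 0 l) (fun y => eta_at c y k) x)).
  have dau : differentiable (fun y => a - xi_deriv c y) x.
    by apply: differentiableB => //; exact: differentiable_cst.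
  have Dau : 'D_(delta_mx 0 l) (fun y => a - xi_deriv c y) x
      = - 'D_(delta_mx 0 l) (xi_deriv c) x.
    rewrite -[fun y => _]/(cst a - xi_deriv c) deriveB.
        by rewrite derive_cst sub0r.
      exact: derivable_cst.
    exact: diff_derivable.
  apply: is_deriveD.
    by apply: derivableP; apply: diff_derivable; exact: dpF.
  rewrite -Dau; apply: is_derive_mul => //; exact: differentiable_form.
have ddv k : differentiable (v k) x.
  apply: differentiableD; first exact: dpF.
  apply: differentiableM; last exact: differentiable_form.
  by apply: differentiableB => //; exact: differentiable_cst.
(* The partial derivatives of [xi_deriv] inherit from [v k], with which they agree near [x], the
   differentiability that [derive_comm] asks for. *)
have ddu k : differentiable ('D_(delta_mx 0 k) (xi_deriv c)) x.
  exact: near_eq_differentiable (uv k) (ddv k).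
have C : 'D_(delta_mx 0 j) ('D_(delta_mx 0 i) (xi_deriv c)) x =
    'D_(delta_mx 0 i) ('D_(delta_mx 0 j) (xi_deriv c)) x.
  apply: derive_comm => //.
  by apply: filterS (chart_image_near cx) => y; exact: differentiable_xi_deriv.
have Cv : 'D_(delta_mx 0 j) (v i) x = 'D_(delta_mx 0 i) (v j) x.
  apply: etrans (near_eq_derive (delta_mx 0 j) (uv i)) _.
  exact: etrans C (esym (near_eq_derive (delta_mx 0 i) (uv j))).
have CF : 'D_(delta_mx 0 j) ('D_(delta_mx 0 i) (F c)) x =
    'D_(delta_mx 0 i) ('D_(delta_mx 0 j) (F c)) x.
  apply: derive_comm; [|exact: dpF|exact: dpF].
  by apply: filterS (chart_image_near cx) => y; exact: dF.
have [_ Ei] := dv i j; have [_ Ej] := dv j i.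
(* Pure algebra: [P1], [P2] stand for second derivatives of f, [E1], [E2] for derivatives of eta,
   [u1], [u2] and [Q1], [Q2] for partial derivatives of u and f, [b] for a - u, and [e1], [e2] for
   components of eta. *)
have cancel (P1 P2 E1 E2 u1 u2 Q1 Q2 b e1 e2 : R) : P1 = P2 -> E1 = E2 ->
    u1 = Q1 + b * e1 -> u2 = Q2 + b * e2 ->
    P1 + (- u2 * e1 + b * E1) = P2 + (- u1 * e2 + b * E2) -> Q1 * e2 = Q2 * e1.
  move=> -> -> -> -> /addrI /addIr; rewrite !mulNr => /oppr_inj.
  by rewrite !mulrDl (mulrAC b e2) => /addIr.
exact: (cancel _ _ _ _ _ _ _ _ _ _ _ CF (form_closed lc ken j i cx)
  (derive_xi_deriv i cx) (derive_xi_deriv j cx) (etrans (esym Ei) (etrans Cv Ej))).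
Qed.

(** Contraction of df /\ eta = 0 with xi, where eta(xi) = 1. *)
Lemma gradient_partial c j x : chart_image c x ->
  'D_(delta_mx 0 j) (F c) x = xi_deriv c x * eta_at c x j.
Proof.
move=> cx; rewrite /xi_deriv mulr_suml.
under eq_bigr do rewrite -mulrA gradient_wedge_form// mulrCA.
rewrite -mulr_sumr -[LHS]mulr1 -(form_at_xi ken.1 cx); congr (_ * _).
by rewrite /form_at mxE; apply: eq_bigr => i _; rewrite -[in RHS]rowE mxE.
Qed.

(** The vector w = V - u xi has g(w, w) = df(w) - u eta(w), which [gradient_partial] makes 0;
    positivity of the metric gives w = 0. *)
Lemma gradient_collinear c x : chart_image c x -> V c x = xi_deriv c x *: xi c x.
Proof.
move=> cx; apply/eqP; rewrite -subr_eq0; apply/eqP.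
apply: (metric_at_eq0 (g := g) cx); set w := _ - _.
rewrite {1}/w metric_at_subl metric_at_scalel grad_f//.
rewrite [X in _ - _ * X](metric_atC g)// -(form_at_metric ken.1)//.
rewrite derive_partial; last exact: dF.
under eq_bigr do rewrite gradient_partial// -[_ *: _]/(_ * _) mulrCA form_at_delta.
by rewrite -mulr_sumr /form_at mxE subrr.
Qed.

End Soliton.

(** * Passage from charts to the manifold *)

Lemma pointwise_collinear_of_charts (R : realType) (m : nat)
    (M : smooth_manifold R m) (V xi : vector_field M) :
  (forall (c : chart M) x, chart_image c x -> exists r : R, V c x = r *: xi c x) ->
  pointwise_collinear V xi.
Proof.
move=> H.
have /choice[h hP] (q : M) : exists r : R, forall c : chart M, dom c q ->
    V c (coordinate c q) = r *: xi c (coordinate c q).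
  have [c cq] := dom_cover q.
  have cx : chart_image c (coordinate c q) by exists q.
  (* The factor found in one chart around [q] serves in any other chart [d], since both fields
     transform by the same Jacobian matrix. *)
  have [r Er] := H c _ cx; exists r => d dq.
  have cd : overlap c d (coordinate c q) by exists q.
  have <- : transition c d (coordinate c q) = coordinate d q.
    by rewrite /transition /= coordinateK.
  by rewrite !vf_transform// Er -scalemxAl.
by exists h => c q; exact: hP.
Qed.

Theorem theorem4p2 (R : realType) (n : nat) (n_gt0 : (0 < n)%N)
    (M : smooth_manifold R (2 * n + 1)) (g : riemannian_metric M)
    (D : connection M) (phi : tensor11_field M) (xi : vector_field M)
    (eta : one_form M) (f : M -> R) (V : vector_field M) (lambda mu p : R) :
  levi_civita g D ->
  kenmotsu g D phi xi eta ->
  gradient_conformal_eta_ricci_soliton g D eta f V lambda mu p ->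
  pointwise_collinear V xi.
Proof.
move=> lc ken [sf gf sol]; apply: pointwise_collinear_of_charts => c x cx.
by exists (xi_deriv xi f c x); exact: (gradient_collinear lc ken sf gf sol).
Qed.
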